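(* Let $k=k(n)$ be integers with $k(n)=\omega(\log n)$ and $k(n)\le n$. Then for all sufficiently large $n$ there is a function $F:\{0,1\}^{n\times n}\to\{0,1\}$ such that, when $n$ processors are given the rows of the input matrix (processor $i$ gets row $i$): 1. there is a $k$-round $\mathsf{BCAST}(1)$ protocol that computes $F$ exactly (on every input); and 2. no $\mathsf{BCAST}(1)$ protocol with at most $k/20$ rounds computes $F$ correctly with probability $0.99$ when the input is uniformly random in $\{0,1\}^{n\times n}$.
   Context: In the $\mathsf{BCAST}(1)$ (Broadcast Congested Clique) model there are $n$ processors numbered $1,\dots,n$, each holding a private input string and having unlimited computational power. Computation proceeds in synchronous rounds; in each round every processor broadcasts a single bit (the same bit to all processors), which may depend on its index, its input, its random bits (independent of the inputs) and all bits broadcast in previous rounds. At the end a processor's output is a function of its input, its random bits and all broadcast bits. A protocol computes $F$ exactly if on every input all processors output the value of $F$; a protocol computes $F$ correctly with probability $q$ over the uniform distribution if some processor's output equals $F$ with probability at least $q$ over a uniformly random input (and the protocol's randomness). *)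

(* Defs.v *)
From mathcomp Require Import all_boot all_order all_algebra.
From mathcomp Require Import all_classical all_reals all_analysis.

Set Implicit Arguments.
Unset Strict Implicit.
Unset Printing Implicit Defensive.

Import Order.TTheory GRing.Theory Num.Theory.
Import numFieldNormedType.Exports.

Local Open Scope ring_scope.

(* The bits broadcast so far: one entry per completed round, in chronological
   order, each giving the bit broadcast by every processor. *)
Definition history (n : nat) := seq {ffun 'I_n -> bool}.

(* A BCAST(1) protocol for n processors, each holding an l-bit input.  The
   number of the current round is the size of the history. *)
Record protocol (n l : nat) := Protocol {
  rounds : nat;
  coins : nat;
  broadcast : 'I_n -> 'rV[bool]_l -> coins.-tuple bool -> history n -> bool;
  decide : 'I_n -> 'rV[bool]_l -> coins.-tuple bool -> history n -> bool }.

Arguments broadcast {n l} p _ _ _ _.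
Arguments decide {n l} p _ _ _ _.

(* Private randomness: one string of random bits for each processor. *)
Definition randomness (n l : nat) (P : protocol n l) :=
  {ffun 'I_n -> (coins P).-tuple bool}.

Fixpoint history_after (n l : nat) (P : protocol n l) (x : 'M[bool]_(n, l))
    (w : randomness P) (t : nat) : history n :=
  if t is t'.+1 then
    let h := history_after x w t' in
    rcons h [ffun i => broadcast P i (row i x) (w i) h]
  else [::].

Definition output (n l : nat) (P : protocol n l) (x : 'M[bool]_(n, l))
    (w : randomness P) (i : 'I_n) : bool :=
  decide P i (row i x) (w i) (history_after x w (rounds P)).

Definition computes_exactly (n l : nat) (P : protocol n l)
    (F : 'M[bool]_(n, l) -> bool) : Prop :=
  forall (x : 'M[bool]_(n, l)) (w : randomness P) (i : 'I_n),
    output x w i = F x.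

(* Probability that processor i outputs F x, for an input x and independent
   random bits w both uniform. *)
Definition success_prob (R : realType) (n l : nat) (P : protocol n l)
    (F : 'M[bool]_(n, l) -> bool) (i : 'I_n) : R :=
  #|[set xw : 'M[bool]_(n, l) * randomness P
      | output xw.1 xw.2 i == F xw.1]|%:R
  / #|{: 'M[bool]_(n, l) * randomness P}|%:R.

Definition computes_with_prob (R : realType) (q : R) (n l : nat)
    (P : protocol n l) (F : 'M[bool]_(n, l) -> bool) : Prop :=
  exists i : 'I_n, q <= success_prob R P F i.

(* Main.v *)
Require Import Defs.
From mathcomp Require Import all_boot all_order all_algebra.
From mathcomp Require Import all_classical all_reals all_analysis.
From mathcomp Require Import zify lra.

Set Implicit Arguments.
Unset Strict Implicit.
Unset Printing Implicit Defensive.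

Import Order.TTheory GRing.Theory Num.Theory.
Import numFieldNormedType.Exports.

Local Open Scope ring_scope.
Local Open Scope classical_set_scope.

(** Counting.  With [N = 2 ^ (n * k)] there are [2 ^ N] functions of the first
    [k] columns, and each of them is computed in [k] rounds by broadcasting these
    columns.  Fix the randomness and the remaining columns: what a processor
    outputs after [t] rounds is then determined, for each of the [2 ^ (n * t)]
    transcripts, by the rows of each processor that are compatible with it and by
    the decision of the processor as a function of its own row.  This leaves at
    most [n * 2 ^ ((n + 1) * 2 ^ (n * t + k))] outputs, each of which agrees on
    7/8 of the arguments with at most [2 ^ (5 * N / 8)] functions.  When [t] is
    at most [k / 20] these do not exhaust all functions, so some function agrees
    with every output on less than 7/8 of the arguments, and averaging over the
    randomness and the other columns keeps this bound. *)

Definition agreement (T : finType) (f g : T -> bool) : nat :=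
  (\sum_x (f x == g x))%N.

(** The sum factors over the points of [T]: each contributes [a] for the value of [g] there and 1
    for the other value. *)
Lemma sum_exp_agreement (T : finType) (g : T -> bool) (a : nat) :
  (\sum_(f : {ffun T -> bool}) a ^ agreement f g = a.+1 ^ #|T|)%N.
Proof.
rewrite (eq_bigr (fun f : {ffun T -> bool} => \prod_x a ^ (f x == g x))%N);
  last by move=> f _; rewrite /agreement expn_sum.
rewrite -(bigA_distr_bigA (fun x b => a ^ (b == g x))%N).
rewrite (eq_bigr (fun=> a.+1)); first by rewrite prod_nat_const.
by move=> x _; rewrite big_bool; case: (g x); rewrite /= expn1 expn0 ?addn1.
Qed.

(** A Chernoff bound: Markov's inequality for [3 ^ agreement f g], whose total over all [f] is
    [4 ^ (8 * q)]. *)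
Lemma card_agreement_ge (T : finType) (g : T -> bool) (q : nat) :
  #|T| = (8 * q)%N ->
  (#|[set f : {ffun T -> bool} | 7 * q <= agreement f g]%SET| <= 2 ^ (5 * q))%N.
Proof.
move=> cardT; set B := [set f | _]%SET.
have leB : (#|B| * 3 ^ (7 * q) <= 2 ^ (16 * q))%N.
  have -> : (2 ^ (16 * q) = 4 ^ #|T|)%N.
    by rewrite cardT -(expnM 2 2); congr (2 ^ _)%N; lia.
  rewrite -(sum_exp_agreement g) -sum_nat_const [leqRHS](bigID (mem B)) /=.
  apply: leq_trans (leq_addr _ _); apply: leq_sum => f.
  by rewrite inE => ?; rewrite leq_pexp2l.
(* The numerical fact behind this is [2 ^ 11 = 2048 <= 2187 = 3 ^ 7]. *)
have le23 : (2 ^ (11 * q) <= 3 ^ (7 * q))%N.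
  by rewrite !expnM; case: q {cardT B leB} => // q; rewrite leq_exp2r.
rewrite -(@leq_pmul2r (2 ^ (11 * q))) ?expn_gt0// -expnD.
rewrite (_ : 5 * q + 11 * q = 16 * q)%N; last by lia.
by apply: leq_trans _ leB; rewrite leq_mul2l le23 orbT.
Qed.

(** Union bound: the functions that agree too well with some [D c] number less than
    [2 ^ (3 * q) * 2 ^ (5 * q) = 2 ^ #|T|]. *)
Lemma hard_function (T C : finType) (D : C -> T -> bool) (q : nat) :
  #|T| = (8 * q)%N -> (#|C| < 2 ^ (3 * q))%N ->
  exists f : T -> bool, forall c, (agreement f (D c) < 7 * q)%N.
Proof.
move=> cardT cardC.
pose B c := [set f : {ffun T -> bool} | (7 * q <= agreement f (D c))%N]%SET.
have /existsP[f fP] : [exists f, f \notin (\bigcup_c B c)%SET].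
  apply: contraLR cardC => /existsPn BT; rewrite -leqNgt.
  rewrite -(@leq_pmul2r (2 ^ (5 * q))) ?expn_gt0// -expnD.
  have -> : (3 * q + 5 * q = #|T|)%N by lia.
  have -> : (2 ^ #|T| = #|\bigcup_c B c|%SET)%N.
    rewrite -[2%N]card_bool -card_ffun.
    by apply/esym/eq_card => f; have := BT f; rewrite negbK => ->.
  have leU : (#|\bigcup_c B c|%SET <= \sum_c #|B c|)%N.
    elim/big_rec2: _ => [|c m A _ leA]; first by rewrite cards0.
    by apply: leq_trans (leq_card_setU _ _) _; rewrite leq_add2l.
  apply: leq_trans leU _; rewrite -sum_nat_const.
  by apply: leq_sum => c _; apply: card_agreement_ge.
exists f => c; rewrite ltnNge; apply: contra fP => fB.
by apply/bigcupP; exists c; rewrite ?inE.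
Qed.

Section Transcripts.
Variables (n l : nat) (P : protocol n l) (x : 'M[bool]_(n, l)).
Variable w : randomness P.

Lemma size_history_after t : size (history_after x w t) = t.
Proof. by elim: t => //= t IH; rewrite size_rcons IH. Qed.

Lemma take_history_after s t :
  (s <= t)%N -> take s (history_after x w t) = history_after x w s.
Proof.
elim: t => [|t IH]; first by rewrite leqn0 => /eqP->.
rewrite leq_eqVlt ltnS => /orP[/eqP->|st].
  by rewrite take_oversize// size_history_after.
by rewrite /= -cats1 takel_cat ?size_history_after// IH.
Qed.

(** For a fixed [h] the recursion disappears: producing [h] splits into separate conditions on each
    processor's own row. *)
Lemma history_after_eqP t (h : history n) : size h = t ->
  reflect (forall (j : 'I_n) (s : 'I_t),
             nth [ffun=> false] h s j
             = broadcast P j (row j x) (w j) (take s h))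
          (history_after x w t == h).
Proof.
move=> sz_h; apply: (iffP eqP) => [<- j s|hP].
  rewrite take_history_after 1?ltnW//.
  rewrite -(nth_take _ (ltnSn s)) take_history_after//=.
  by rewrite nth_rcons size_history_after ltnn eqxx ffunE.
suff H s : (s <= t)%N -> history_after x w s = take s h.
  by rewrite H// -sz_h take_size.
elim: s => [|s IH] st; first by rewrite take0.
rewrite (take_nth [ffun=> false]) ?sz_h//= IH 1?ltnW//; congr rcons.
by apply/ffunP => j; rewrite ffunE (hP j (Ordinal st)).
Qed.

End Transcripts.

(* The inputs producing a given transcript form a rectangle: [c (Some j, h, _)]
   tells which rows of processor [j] are compatible with the transcript [h], and
   [c (None, h, _)] is the decision of processor [i] after [h]. *)
Definition decode (n k t : nat)
    (ci : {ffun option 'I_n * t.-tuple {ffun 'I_n -> bool} * 'rV[bool]_k -> bool}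
          * 'I_n)
    (z : 'M[bool]_(n, k)) : bool :=
  [exists h, [forall j, ci.1 (Some j, h, row j z)]
             && ci.1 (None, h, row ci.2 z)].

Lemma output_decode (n k l t : nat) (P : protocol n (k + l))
    (w : randomness P) (y : 'M[bool]_(n, l)) (i : 'I_n) :
  (rounds P <= t)%N ->
  exists ci, forall z, output (row_mx z y) w i = @decode n k t ci z.
Proof.
move=> le_t.
pose ok j (h : history n) v := [forall s : 'I_t,
  nth [ffun=> false] h s j
  == broadcast P j (row_mx v (row j y)) (w j) (take s h)].
(* Transcripts are padded to length [t], whatever [rounds P] is; truncating [h] recovers what the
   decision of [P] sees. *)
exists ([ffun a : option 'I_n * t.-tuple {ffun 'I_n -> bool} * 'rV_k =>
  if a.1.1 is Some j then ok j a.1.2 a.2 else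
  decide P i (row_mx a.2 (row i y)) (w i) (take (rounds P) a.1.2)], i) => z.
have okE (h : t.-tuple {ffun 'I_n -> bool}) :
    [forall j, ok j h (row j z)] = (history_after (row_mx z y) w t == h).
  apply/forallP/(history_after_eqP _ _ (size_tuple h)) => [H j s|H j].
    by have /forallP/(_ s)/eqP := H j; rewrite row_row_mx.
  by apply/forallP => s; rewrite H row_row_mx.
rewrite /output /decode /= row_row_mx -(take_history_after _ _ le_t).
apply/idP/existsP => [out|[h]].
  have sz := introT eqP (size_history_after (row_mx z y) w t).
  exists (Tuple sz); rewrite ffunE /= out andbT.
  by under eq_forallb do rewrite ffunE; rewrite okE.
under eq_forallb do rewrite ffunE.
by rewrite okE ffunE /= => /andP[/eqP <-].
Qed.

Lemma full_history (n k l : nat) (G : 'M[bool]_(n, k) -> bool) :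
  exists P : protocol n (k + l),
    rounds P = k /\ computes_exactly P (fun x => G (lsubmx x)).
Proof.
(* In each round a processor broadcasts the entry of its row indexed by the round number, which is
   the size of [h]; entry [(a, b)] of the matrix is thus the bit of processor [a] in round [b]. *)
pose P := @Protocol n (k + l) k 0
  (fun i v _ h => nth false [seq v ord0 (lshift l j) | j <- enum 'I_k] (size h))
  (fun i v _ h => G (\matrix_(a, b) nth [ffun=> false] h b a)).
exists P; split=> // x w i; rewrite /output /=; congr G.
apply/matrixP => a b; rewrite !mxE.
rewrite (elimT (history_after_eqP x w (size_history_after x w k)) (eqxx _)).
rewrite /= take_history_after 1?ltnW// size_history_after.
by rewrite (nth_map b) ?size_enum_ord// nth_ord_enum !mxE.
Qed.

(** Averaging: the successful pairs are counted fibre by fibre, with [w] and the last [l] columns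
    [y] fixed. *)
Lemma success_prob_le (R : realType) (n k l q : nat) (P : protocol n (k + l))
    (G : 'M[bool]_(n, k) -> bool) (i : 'I_n) :
  #|{: 'M[bool]_(n, k)}| = (8 * q)%N ->
  (forall (w : randomness P) (y : 'M[bool]_(n, l)),
     (agreement G (fun z => output (row_mx z y) w i) <= 7 * q)%N) ->
  success_prob R P (fun x => G (lsubmx x)) i <= 7 / 8.
Proof.
move=> cardM le7; rewrite /success_prob.
set S := [set xw | _]%SET.
have cardS : (#|S| <= #|randomness P| * (#|{: 'M[bool]_(n, l)}| * (7 * q)))%N.
  have -> : #|S| = (\sum_(w : randomness P) \sum_(y : 'M[bool]_(n, l))
                     agreement G (fun z => output (row_mx z y) w i))%N.
    have -> : #|S| = (\sum_(xw : 'M[bool]_(n, k + l) * randomness P)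
                       (G (lsubmx xw.1) == output xw.1 xw.2 i))%N.
      rewrite -sum1_card big_mkcond; apply: eq_bigr => xw _.
      by rewrite inE eq_sym; case: eqP.
    rewrite -(pair_bigA _ (fun x w => G (lsubmx x) == output x w i : nat)%N).
    rewrite exchange_big /=; apply: eq_bigr => w _.
    rewrite [RHS]exchange_big pair_bigA /=.
    rewrite (reindex (fun zy => row_mx zy.1 zy.2)) /=.
      by apply: eq_bigr => -[z y] _ /=; rewrite row_mxKl.
    exists (fun x => (lsubmx x, rsubmx x)) => [[z y]|x] _ /=.
      by rewrite row_mxKl row_mxKr.
    by rewrite hsubmxK.
  rewrite -!sum_nat_const; apply: leq_sum => w _.
  by apply: leq_sum => y _.
have cardE : #|{: 'M[bool]_(n, k + l) * randomness P}|
    = (#|randomness P| * (#|{: 'M[bool]_(n, l)}| * (8 * q)))%N.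
  by rewrite card_prod -cardM !card_mx mulnDr expnD mulnC (mulnC (_ ^ _)%N).
rewrite cardE ler_pdivrMr; last first.
  rewrite ltr0n -cardE.
  by apply/card_gt0P; exists (const_mx false, [ffun=> [tuple of nseq _ false]]).
move: cardS; rewrite -(ler_nat R) => /le_trans; apply.
rewrite !natrM; set a := #|_|%:R; set b := #|_|%:R; lra.
Qed.

(** The exponent is [(n + 1) * 2 ^ (n * t + k)], plus at most [n] for the choice of processor. Since
    [n + 1 <= 2 ^ n], either summand is at most [2 ^ (n * k - 3)]. *)
Lemma card_decode_lt (n k t : nat) : (n * t + n + k + 3 <= n * k)%N ->
  (#|{: {ffun option 'I_n * t.-tuple {ffun 'I_n -> bool} * 'rV[bool]_k -> bool}
        * 'I_n}| < 2 ^ (3 * 2 ^ (n * k - 3)))%N.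
Proof.
move=> le_nk; rewrite card_prod card_ffun !card_prod card_option card_tuple.
rewrite card_ffun card_mx card_bool !card_ord mul1n -expnM.
apply: (@leq_trans (2 ^ (n.+1 * 2 ^ (n * t) * 2 ^ k + n))).
  by rewrite expnD ltn_pmul2l ?expn_gt0// ltn_expl.
rewrite leq_exp2l//.
have leE : (2 ^ n * 2 ^ (n * t) * 2 ^ k <= 2 ^ (n * k - 3))%N.
  by rewrite -!expnD leq_exp2l//; lia.
have le1 : (n.+1 * 2 ^ (n * t) * 2 ^ k <= 2 ^ n * 2 ^ (n * t) * 2 ^ k)%N.
  by rewrite !leq_mul2r ltn_expl// !orbT.
have le2 : (n <= 2 ^ n * 2 ^ (n * t) * 2 ^ k)%N.
  apply: leq_trans (ltnW (ltn_expl n (ltnSn 1))) _.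
  by rewrite -mulnA leq_pmulr// muln_gt0 !expn_gt0.
lia.
Qed.

Lemma round_hierarchy (R : realType) (n k l t : nat) :
  (n * t + n + k + 3 <= n * k)%N ->
  exists F : 'M[bool]_(n, k + l) -> bool,
    (exists P : protocol n (k + l), rounds P = k /\ computes_exactly P F) /\
    forall P : protocol n (k + l), (rounds P <= t)%N ->
      forall i, success_prob R P F i <= 7 / 8.
Proof.
move=> le_nk.
have cardM : #|{: 'M[bool]_(n, k)}| = (8 * 2 ^ (n * k - 3))%N.
  by rewrite card_mx card_bool -(expnD 2 3); congr (2 ^ _)%N; lia.
have [G GP] := hard_function (@decode n k t) cardM (card_decode_lt le_nk).
exists (fun x => G (lsubmx x)); split; first exact: full_history.
move=> P le_t i; apply: success_prob_le cardM _ => w y.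
have [ci ciE] := output_decode w y i le_t.
by rewrite /agreement; under eq_bigr do rewrite ciE; apply/ltnW/GP.
Qed.

Lemma near_ln_ge (R : realType) (c : R) : \forall n \near \oo, c <= ln (n%:R : R).
Proof.
near=> n.
have n_ge : expR c <= n%:R by near: n; exact: nbhs_infty_ger.
rewrite -[c]expRK ler_ln ?posrE ?expR_gt0//.
exact: lt_le_trans (expR_gt0 c) n_ge.
Unshelve. all: by end_near. Qed.

Theorem theorem1p5 (R : realType) (k : nat -> nat)
    (k_omega_log : (fun n : nat => ln (n%:R : R)) =o_\oo
                   (fun n : nat => (k n)%:R : R))
    (k_le : forall n : nat, (k n <= n)%N) :
  \forall n \near \oo, exists F : 'M[bool]_n -> bool,
    (exists P : protocol n n, rounds P = k n /\ computes_exactly P F) /\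
    ~ (exists P : protocol n n,
         (rounds P)%:R <= (k n)%:R / 20 :> R /\
         computes_with_prob (99 / 100 : R) P F).
Proof.
(* Little-o with constant 1 gives [ln n <= k n] eventually, and [ln n] eventually exceeds 4. *)
have k_ge : \forall n \near \oo, (4 <= k n)%N.
  have /eqoP/(_ 1 ltr01) := k_omega_log.
  apply: filterS2 (@near_ln_ge R 4) => n ln_ge; rewrite mul1r => le_k.
  rewrite -(ler_nat R) (le_trans ln_ge)// (le_trans (ler_norm _))//.
  by rewrite (le_trans le_k)// ger0_norm.
apply: filterS k_ge => n k4; have kn := k_le n.
(* Here [k n + 3 <= 2 * n], and [k n %/ 20 + 3 <= k n] because [k n] is at least 4. *)
have bound : (n * (k n %/ 20) + n + k n + 3 <= n * k n)%N by nia.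
have := round_hierarchy R (n - k n) bound.
rewrite subnKC// => -[F [easy hard]]; exists F; split=> // -[P [le_rounds [i]]].
have le_t : (rounds P <= k n %/ 20)%N.
  by rewrite leq_divRL// -(ler_nat R) natrM -ler_pdivlMr.
(* The contradiction is [99 / 100 > 7 / 8]. *)
have := hard P le_t i; lra.
Qed.
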